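(* In $\mathbf{ZF}$, for every infinite set $X$, neither the space $\mathbf{S}_{\mathcal{P}}(X,[X]^{<\omega})$ nor the Cantor cube $\mathbf{2}^X$ ($=2^X[[X]^{<\omega}]$) is a $P$-space.
   Context: The background theory is $\mathbf{ZF}$ (no axiom of choice). $[X]^{<\omega}$ is the set of finite subsets of $X$. $\mathbf{2}^X$ is the set $\{0,1\}^X$ with the product topology, where $\{0,1\}$ is discrete; equivalently, it is the space $2^X[[X]^{<\omega}]$ whose topology has as a base the sets $\{f\in\{0,1\}^X:p\subseteq f\}$ with $p:z\to\{0,1\}$ for a non-empty finite $z\subseteq X$. $\mathbf{S}_{\mathcal{P}}(X,[X]^{<\omega})$ is the set $\mathcal{P}(X)$ with the topology consisting of all $V\subseteq\mathcal{P}(X)$ such that for every $x\in V$ there is a finite $z\subseteq X$ with $x\cap z=\emptyset$ and $\{y\in\mathcal{P}(X):x\subseteq y\subseteq X\setminus z\}\subseteq V$. A $P$-space is a topological space in which every $G_\delta$-set (countable intersection of open sets) is open. *)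

(* Defs.v *)
(* "In ZF" is rendered as "in every model of first-order ZF": a model is a
   type with a binary relation, and every notion below is a first-order
   property over it (all quantifiers range over the model).  The ambient logic
   cannot smuggle choice into the model, since separation and replacement are
   only assumed for formulas of the language of set theory. *)

Inductive formula : Type :=
| FMem (i j : nat)
| FEq (i j : nat)
| FBot
| FAnd (p q : formula)
| FOr (p q : formula)
| FImp (p q : formula)
| FAll (p : formula)
| FEx (p : formula).

Definition scons {A : Type} (x : A) (e : nat -> A) (n : nat) : A :=
  match n with O => x | S m => e m end.

(* Variables are de Bruijn indices looked up in [e]. *)
Fixpoint sat {A : Type} (E : A -> A -> Prop) (e : nat -> A) (p : formula)
  : Prop :=
  match p with
  | FMem i j => E (e i) (e j)
  | FEq i j => e i = e j
  | FBot => False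
  | FAnd p q => sat E e p /\ sat E e q
  | FOr p q => sat E e p \/ sat E e q
  | FImp p q => sat E e p -> sat E e q
  | FAll p => forall x, sat E (scons x e) p
  | FEx p => exists x, sat E (scons x e) p
  end.

(* In the two schemas, the environment [e] supplies the parameters. *)
Record zf_model : Type := {
  carrier :> Type;
  mem : carrier -> carrier -> Prop;
  extensionality : forall x y,
    (forall t, mem t x <-> mem t y) -> x = y;
  foundation : forall x, (exists t, mem t x) ->
    exists y, mem y x /\ ~ (exists t, mem t x /\ mem t y);
  pairing : forall a b, exists z, forall t, mem t z <-> t = a \/ t = b;
  union : forall x, exists u, forall t,
    mem t u <-> exists y, mem y x /\ mem t y;
  power_set : forall x, exists p, forall y,
    mem y p <-> (forall t, mem t y -> mem t x);
  infinity : exists w,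
    (exists o, (forall t, ~ mem t o) /\ mem o w) /\
    (forall n, mem n w ->
       exists s, (forall t, mem t s <-> mem t n \/ t = n) /\ mem s w);
  separation : forall (phi : formula) (e : nat -> carrier) a,
    exists b, forall x, mem x b <-> mem x a /\ sat mem (scons x e) phi;
  replacement : forall (phi : formula) (e : nat -> carrier) a,
    (forall x y y', mem x a ->
       sat mem (scons x (scons y e)) phi ->
       sat mem (scons x (scons y' e)) phi -> y = y') ->
    exists b, forall y,
      mem y b <-> exists x, mem x a /\ sat mem (scons x (scons y e)) phi
}.

Notation "x ∈ y" := (mem _ x y) (at level 70, no associativity).
Notation "x ⊆ y" := (forall t, mem _ t x -> mem _ t y)
  (at level 70, no associativity).

Definition is_empty {M : zf_model} (o : M) : Prop := forall t, ~ t ∈ o.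

Definition disjoint {M : zf_model} (x y : M) : Prop :=
  forall t, ~ (t ∈ x /\ t ∈ y).

Definition is_difference {M : zf_model} (x y d : M) : Prop :=
  forall t, t ∈ d <-> t ∈ x /\ ~ t ∈ y.

Definition is_union {M : zf_model} (U V : M) : Prop :=
  forall t, t ∈ V <-> exists W, W ∈ U /\ t ∈ W.

Definition is_intersection2 {M : zf_model} (x y d : M) : Prop :=
  forall t, t ∈ d <-> t ∈ x /\ t ∈ y.

Definition is_power_set {M : zf_model} (X P : M) : Prop :=
  forall y, y ∈ P <-> y ⊆ X.

Definition is_unordered_pair {M : zf_model} (a b z : M) : Prop :=
  forall t, t ∈ z <-> t = a \/ t = b.

(* Kuratowski pairs: p = {{a}, {a, b}}. *)
Definition is_pair {M : zf_model} (a b p : M) : Prop :=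
  exists s d, is_unordered_pair a a s /\ is_unordered_pair a b d /\
              is_unordered_pair s d p.

Definition maps {M : zf_model} (f a b : M) : Prop :=
  exists p, is_pair a b p /\ p ∈ f.

Definition is_function {M : zf_model} (f A B : M) : Prop :=
  (forall p, p ∈ f -> exists a b, a ∈ A /\ b ∈ B /\ is_pair a b p) /\
  (forall a, a ∈ A -> exists! b, maps f a b).

Definition is_injection {M : zf_model} (f A B : M) : Prop :=
  is_function f A B /\
  (forall a a' b, maps f a b -> maps f a' b -> a = a').

Definition is_bijection {M : zf_model} (f A B : M) : Prop :=
  is_injection f A B /\
  (forall b, b ∈ B -> exists a, a ∈ A /\ maps f a b).

Definition is_successor {M : zf_model} (n s : M) : Prop :=
  forall t, t ∈ s <-> t ∈ n \/ t = n.

Definition inductive {M : zf_model} (w : M) : Prop :=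
  (exists o, is_empty o /\ o ∈ w) /\
  (forall n, n ∈ w -> exists s, is_successor n s /\ s ∈ w).

(* The von Neumann natural numbers of the model; they may be nonstandard. *)
Definition is_natural {M : zf_model} (n : M) : Prop :=
  forall w : M, inductive w -> n ∈ w.

Definition is_omega {M : zf_model} (w : M) : Prop :=
  forall n, n ∈ w <-> is_natural n.

Definition finite {M : zf_model} (A : M) : Prop :=
  exists n f, is_natural n /\ is_bijection f A n.

Definition infinite {M : zf_model} (A : M) : Prop := ~ finite A.

Definition countable {M : zf_model} (A : M) : Prop :=
  exists w f, is_omega w /\ is_injection f A w.

(* The empty set is open as the union of the empty family. *)
Definition topological_space {M : zf_model} (S T : M) : Prop :=
  (forall V, V ∈ T -> V ⊆ S) /\
  S ∈ T /\
  (forall V W D, V ∈ T -> W ∈ T -> is_intersection2 V W D -> D ∈ T) /\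
  (forall U V, U ⊆ T -> is_union U V -> V ∈ T).

(* Guarding by [x ∈ S] makes the intersection of the empty family equal S. *)
Definition is_G_delta {M : zf_model} (S T G : M) : Prop :=
  exists U, countable U /\ U ⊆ T /\
    (forall x, x ∈ G <-> x ∈ S /\ (forall V, V ∈ U -> x ∈ V)).

Definition P_space {M : zf_model} (S T : M) : Prop :=
  topological_space S T /\ (forall G, is_G_delta S T G -> G ∈ T).

(* (S, T) is the space S_P(X, [X]^{<ω}). *)
Definition is_SP_space {M : zf_model} (X S T : M) : Prop :=
  is_power_set X S /\
  (forall V, V ∈ T <->
     V ⊆ S /\
     (forall x, x ∈ V ->
        exists z d, finite z /\ z ⊆ X /\ disjoint x z /\ is_difference X z d /\
          (forall y, x ⊆ y -> y ⊆ d -> y ∈ V))).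

(* The ordinal 2 = {0, 1} = {∅, {∅}}. *)
Definition is_two {M : zf_model} (b : M) : Prop :=
  exists o i, is_empty o /\ is_unordered_pair o o i /\ is_unordered_pair o i b.

(* B = {f ∈ C : p ⊆ f} for some p : z -> {0, 1}, z a non-empty finite subset
   of X. *)
Definition is_cantor_basic {M : zf_model} (X C B : M) : Prop :=
  exists z b p, finite z /\ ~ is_empty z /\ z ⊆ X /\ is_two b /\
    is_function p z b /\ (forall f, f ∈ B <-> f ∈ C /\ p ⊆ f).

(* (C, T) is the Cantor cube 2^X = 2^X[[X]^{<ω}]. *)
Definition is_cantor_cube {M : zf_model} (X C T : M) : Prop :=
  (exists b, is_two b /\ (forall f, f ∈ C <-> is_function f X b)) /\
  (forall V, V ∈ T <->
     V ⊆ C /\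
     (forall f, f ∈ V -> exists B, is_cantor_basic X C B /\ f ∈ B /\ B ⊆ V)).

(* Main.v *)
From Stdlib Require Import Classical.
Require Import Defs.

(* Let V_n be the set of y ⊆ X such that n injects into X \ y, for the Cantor
   cube the set of f such that n injects into f^-1(1).  Each V_n is open, since
   the finite range of an injection determines a neighbourhood inside V_n.  By
   pigeonhole a V_n determines n, so {V_n : n ∈ ω} is countable without choice.
   If its intersection were open, the point ∅ (respectively the constant 1) of
   the intersection would have a basic neighbourhood inside it, given by a
   finite z ⊆ X; but this neighbourhood contains X \ z (respectively the
   characteristic function of z), which lies in no V_n with n > |z|. *)

(** * Definability: turning predicates of the ambient logic into formulas *)

Definition definable {M : zf_model} (P : M -> Prop) : Prop :=
  exists phi e, forall x, sat (mem M) (scons x e) phi <-> P x.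

Definition adjoin {M : zf_model} (A x B : M) : Prop :=
  forall t, t ∈ B <-> t ∈ A \/ t = x.

Lemma scons_head {A : Type} (x : A) (e : nat -> A) : scons x e 0 = x.
Proof. reflexivity. Qed.

Lemma scons_tail {A : Type} (x y : A) (e : nat -> A) (i : nat) :
  e i = y -> scons x e (S i) = y.
Proof. easy. Qed.

Section Reification.
Context {A : Type} (E : A -> A -> Prop).
Implicit Types (e : nat -> A) (p q : formula).

(** In this rule and the following ones the proposition on the right is known and the formula on the
    left is an evar, so applying the rules along the shape of the proposition builds the formula by
    unification. *)
Lemma sat_mem e i j x y :
  e i = x -> e j = y -> (sat E e (FMem i j) <-> E x y).
Proof. intros <- <-; reflexivity. Qed.

Lemma sat_eq e i j x y :
  e i = x -> e j = y -> (sat E e (FEq i j) <-> x = y).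
Proof. intros <- <-; reflexivity. Qed.

Lemma sat_bot e : sat E e FBot <-> False.
Proof. reflexivity. Qed.

Lemma sat_true e : sat E e (FImp FBot FBot) <-> True.
Proof. simpl; tauto. Qed.

Lemma sat_and e p q P Q :
  (sat E e p <-> P) -> (sat E e q <-> Q) -> (sat E e (FAnd p q) <-> P /\ Q).
Proof. simpl; tauto. Qed.

Lemma sat_or e p q P Q :
  (sat E e p <-> P) -> (sat E e q <-> Q) -> (sat E e (FOr p q) <-> P \/ Q).
Proof. simpl; tauto. Qed.

Lemma sat_imp e p q (P Q : Prop) :
  (sat E e p <-> P) -> (sat E e q <-> Q) -> (sat E e (FImp p q) <-> (P -> Q)).
Proof. simpl; tauto. Qed.

Lemma sat_not e p P :
  (sat E e p <-> P) -> (sat E e (FImp p FBot) <-> ~ P).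
Proof. simpl; tauto. Qed.

Lemma sat_iff e p q P Q :
  (sat E e p <-> P) -> (sat E e q <-> Q) ->
  (sat E e (FAnd (FImp p q) (FImp q p)) <-> (P <-> Q)).
Proof. simpl; tauto. Qed.

Lemma sat_all e p (P : A -> Prop) :
  (forall x, sat E (scons x e) p <-> P x) ->
  (sat E e (FAll p) <-> forall x, P x).
Proof. intros H; split; intros H' x; apply H, H'. Qed.

Lemma sat_ex e p (P : A -> Prop) :
  (forall x, sat E (scons x e) p <-> P x) -> (sat E e (FEx p) <-> ex P).
Proof. intros H; split; intros [x H']; exists x; apply H, H'. Qed.

End Reification.

(* The tail of the environment is an evar, extended by each parameter that is
   met for the first time. *)
Ltac lookup :=
  lazymatch goal with
  | |- scons ?x _ _ = ?y =>
      first [ constr_eq x y; apply scons_head | apply scons_tail; lookup ]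
  | |- ?e _ = ?y =>
      is_evar e;
      let e' := open_constr:(_) in
      unify e (scons y e'); apply scons_head
  end.

Ltac reify :=
  lazymatch goal with
  | |- _ <-> mem _ _ _ => apply sat_mem; lookup
  | |- _ <-> _ = _ => apply sat_eq; lookup
  | |- _ <-> False => apply sat_bot
  | |- _ <-> True => apply sat_true
  | |- _ <-> _ /\ _ => apply sat_and; reify
  | |- _ <-> _ \/ _ => apply sat_or; reify
  | |- _ <-> ~ _ => apply sat_not; reify
  | |- _ <-> (_ <-> _) => apply sat_iff; reify
  | |- _ <-> ex _ => apply sat_ex; intro; cbv beta; reify
  | |- _ <-> (?P -> _) =>
      (* An arrow may also be a quantifier over the carrier; the type of its domain decides. *)
      lazymatch type of P with
      | Prop => apply sat_imp; reify
      | _ => apply sat_all; intro; cbv beta; reify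
      end
  | |- _ <-> (forall _, _) => apply sat_all; intro; cbv beta; reify
  (* Any other proposition is a defined notion, which is unfolded until a connective appears. *)
  | |- ?L <-> ?Q => let Q' := eval red in Q in change (L <-> Q'); reify
  end.

(* The tail left open is closed by an arbitrary set, so the context of a call
   has to contain one. *)
Ltac definability :=
  unshelve (unfold definable; eexists; eexists; intro; cbv beta; reify);
  match goal with
  | y : carrier _ |- _ => exact (fun _ => y)
  end.

(** The form in which separation is used throughout: each subset formed below costs one proof of
    definability. *)
Lemma comprehension {M : zf_model} (P : M -> Prop) (A : M) :
  definable P -> exists B, forall x, x ∈ B <-> x ∈ A /\ P x.
Proof.
  intros (phi & e & H); destruct (separation M phi e A) as [B HB].
  exists B; intro x; rewrite HB, H; reflexivity.
Qed.

(** * Sets, pairs and functions inside the model *)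

Lemma empty_exists (M : zf_model) : exists o : M, is_empty o.
Proof. destruct (infinity M) as (w & (o & Ho & _) & _); now exists o. Qed.

Lemma empty_unique {M : zf_model} (o o' : M) :
  is_empty o -> is_empty o' -> o = o'.
Proof. intros H H'; apply extensionality; firstorder. Qed.

(** Foundation for the singleton of [x]. *)
Lemma mem_irrefl {M : zf_model} (x : M) : ~ x ∈ x.
Proof.
  intro H; destruct (pairing M x x) as [z Hz].
  destruct (foundation M z) as (y & Hy & Hy').
  - exists x; apply Hz; auto.
  - apply Hy'; exists x; apply Hz in Hy.
    assert (y = x) by tauto; subst y; split; auto; apply Hz; auto.
Qed.

(** Foundation for the unordered pair of [x] and [y]. *)
Lemma mem_asym {M : zf_model} (x y : M) : x ∈ y -> ~ y ∈ x.
Proof.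
  intros H H'; destruct (pairing M x y) as [z Hz].
  destruct (foundation M z) as (t & Ht & Ht').
  - exists x; apply Hz; auto.
  - apply Ht'; apply Hz in Ht as [-> | ->].
    + exists y; split; auto; apply Hz; auto.
    + exists x; split; auto; apply Hz; auto.
Qed.

Lemma union2_exists {M : zf_model} (A B : M) :
  exists C, forall t, t ∈ C <-> t ∈ A \/ t ∈ B.
Proof.
  destruct (pairing M A B) as [z Hz]; destruct (union M z) as [C HC].
  exists C; intro t; rewrite HC; split.
  - intros (y & Hy & Ht); apply Hz in Hy as [-> | ->]; auto.
  - intros [Ht | Ht]; [exists A | exists B]; rewrite Hz; auto.
Qed.

Lemma adjoin_exists {M : zf_model} (A x : M) : exists B, adjoin A x B.
Proof.
  destruct (pairing M x x) as [z Hz]; destruct (union2_exists A z) as [B HB].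
  exists B; intro t; rewrite HB, Hz; tauto.
Qed.

Lemma pair_exists {M : zf_model} (a b : M) : exists p, is_pair a b p.
Proof.
  destruct (pairing M a a) as [s Hs]; destruct (pairing M a b) as [d Hd].
  destruct (pairing M s d) as [p Hp]; now exists p, s, d.
Qed.

Lemma unordered_pair_unique {M : zf_model} (a b z z' : M) :
  is_unordered_pair a b z -> is_unordered_pair a b z' -> z = z'.
Proof. 
  intros H H'; apply extensionality; intro t.
  specialize (H t); specialize (H' t); tauto.
 Qed.

Lemma pair_unique {M : zf_model} (a b p p' : M) :
  is_pair a b p -> is_pair a b p' -> p = p'.
Proof.
  intros (s & d & Hs & Hd & Hp) (s' & d' & Hs' & Hd' & Hp').
  rewrite <- (unordered_pair_unique _ _ _ _ Hs Hs') in Hp'.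
  rewrite <- (unordered_pair_unique _ _ _ _ Hd Hd') in Hp'.
  exact (unordered_pair_unique _ _ _ _ Hp Hp').
Qed.

Lemma unordered_pair_injective {M : zf_model} (a b a' b' z : M) :
  is_unordered_pair a b z -> is_unordered_pair a' b' z ->
  a = a' /\ b = b' \/ a = b' /\ b = a'.
Proof.
  intros H H'.
  assert (Ha : a = a' \/ a = b') by (apply H', H; auto).
  assert (Hb : b = a' \/ b = b') by (apply H', H; auto).
  assert (Ha' : a' = a \/ a' = b) by (apply H, H'; auto).
  assert (Hb' : b' = a \/ b' = b) by (apply H, H'; auto).
  intuition congruence.
Qed.

Lemma pair_injective {M : zf_model} (a b a' b' p : M) :
  is_pair a b p -> is_pair a' b' p -> a = a' /\ b = b'.
Proof.
  intros (s & d & Hs & Hd & Hp) (s' & d' & Hs' & Hd' & Hp').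
  destruct (unordered_pair_injective _ _ _ _ _ Hp Hp') as [[<- <-] | [<- <-]].
  - pose proof (unordered_pair_injective _ _ _ _ _ Hs Hs').
    pose proof (unordered_pair_injective _ _ _ _ _ Hd Hd').
    intuition congruence.
  - pose proof (unordered_pair_injective _ _ _ _ _ Hs Hd').
    pose proof (unordered_pair_injective _ _ _ _ _ Hd Hs').
    intuition congruence.
Qed.

(** A Kuratowski pair of elements of [A] and [B] lies in the double power set of the union of [A]
    and [B], so the graph is obtained by separation from that set. *)
Lemma graph_exists {M : zf_model} (A B : M) (R : M -> M -> Prop) :
  definable (fun p => exists a b, is_pair a b p /\ a ∈ A /\ b ∈ B /\ R a b) ->
  exists f,
    (forall p, p ∈ f -> exists a b, a ∈ A /\ b ∈ B /\ is_pair a b p) /\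
    (forall a b, maps f a b <-> a ∈ A /\ b ∈ B /\ R a b).
Proof.
  intro HR; destruct (union2_exists A B) as [C HC].
  destruct (power_set M C) as [D HD]; destruct (power_set M D) as [F HF].
  destruct (comprehension _ F HR) as [f Hf]; exists f; split.
  - intros p Hp; apply Hf in Hp as (_ & a & b & Hp & Ha & Hb & _).
    now exists a, b.
  - intros a b; split.
    + intros (p & Hp & Hpf); apply Hf in Hpf as (_ & a' & b' & Hp' & H).
      now destruct (pair_injective _ _ _ _ _ Hp Hp') as [<- <-].
    + intros (Ha & Hb & Hab); destruct (pair_exists a b) as [p Hp].
      exists p; split; auto; apply Hf; split; [| now exists a, b].
      destruct Hp as (s & d & Hs & Hd & Hp).
      apply HF; intros t Ht; apply HD; intros u Hu; apply HC.
      apply Hp in Ht as [-> | ->].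
      * apply Hs in Hu as [-> | ->]; auto.
      * apply Hd in Hu as [-> | ->]; auto.
Qed.

Lemma maps_domain {M : zf_model} (f A B a b : M) :
  is_function f A B -> maps f a b -> a ∈ A /\ b ∈ B.
Proof.
  intros [Hf _] (p & Hp & Hpf); destruct (Hf p Hpf) as (a' & b' & Ha & Hb & Hp').
  now destruct (pair_injective _ _ _ _ _ Hp Hp') as [-> ->].
Qed.

Lemma maps_total {M : zf_model} (f A B a : M) :
  is_function f A B -> a ∈ A -> exists b, maps f a b.
Proof. intros [_ Hf] Ha; destruct (Hf a Ha) as (b & Hb & _); now exists b. Qed.

Lemma maps_unique {M : zf_model} (f A B a b b' : M) :
  is_function f A B -> maps f a b -> maps f a b' -> b = b'.
Proof.
  intros Hf Hb Hb'; destruct (maps_domain _ _ _ _ _ Hf Hb) as [Ha _].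
  destruct (proj2 Hf a Ha) as (c & _ & Hc).
  now rewrite <- (Hc b Hb), <- (Hc b' Hb').
Qed.

Lemma mem_function {M : zf_model} (f A B p : M) :
  is_function f A B -> p ∈ f -> exists a b, is_pair a b p /\ maps f a b.
Proof.
  intros [Hf _] Hp; destruct (Hf p Hp) as (a & b & _ & _ & Hab).
  now exists a, b; split; [| exists p].
Qed.

Lemma maps_mem {M : zf_model} (f a b p : M) :
  is_pair a b p -> maps f a b -> p ∈ f.
Proof.
  intros Hp (q & Hq & Hqf); now rewrite (pair_unique _ _ _ _ Hp Hq).
Qed.

Lemma function_exists {M : zf_model} (A B : M) (R : M -> M -> Prop) :
  definable (fun p => exists a b, is_pair a b p /\ a ∈ A /\ b ∈ B /\ R a b) ->
  (forall a, a ∈ A -> exists b, b ∈ B /\ R a b) ->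
  (forall a b b', a ∈ A -> b ∈ B -> b' ∈ B -> R a b -> R a b' -> b = b') ->
  exists f, is_function f A B /\
    (forall a b, maps f a b <-> a ∈ A /\ b ∈ B /\ R a b).
Proof.
  intros HR Htot Huni; destruct (graph_exists A B R HR) as (f & Hf & Hm).
  exists f; split; auto; split; auto.
  intros a Ha; destruct (Htot a Ha) as (b & Hb & Hab); exists b; split.
  - now apply Hm.
  - intros b' Hb'; apply Hm in Hb' as (_ & Hb' & Hab'); eauto.
Qed.

(** * Natural numbers of the model *)

Lemma omega_exists (M : zf_model) : exists w : M, is_omega w.
Proof.
  destruct (infinity M) as (w & (o & Ho & How) & Hs).
  destruct (comprehension (@is_natural M) w) as [b Hb].
  { definability. }
  exists b; intro n; rewrite Hb; split; [tauto |].
  intro Hn; split; auto; apply Hn; split; [now exists o |].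
  intros m Hm; destruct (Hs m Hm) as (s & H); now exists s.
Qed.

Lemma natural_zero {M : zf_model} (o : M) : is_empty o -> is_natural o.
Proof.
  intros Ho w [(o' & Ho' & H) _]; now rewrite (empty_unique o o').
Qed.

Lemma natural_succ {M : zf_model} (n s : M) :
  is_natural n -> is_successor n s -> is_natural s.
Proof.
  intros Hn Hs w Hw; destruct (proj2 Hw n (Hn w Hw)) as (s' & Hs' & H).
  replace s with s'; auto; apply extensionality; intro t.
  specialize (Hs t); specialize (Hs' t); tauto.
Qed.

(** The elements of omega satisfying [P] form an inductive set. Since the naturals may be
    nonstandard, this works only for a definable [P]. *)
Lemma natural_ind {M : zf_model} (P : M -> Prop) :
  definable P ->
  (forall o, is_empty o -> P o) ->
  (forall n s, is_natural n -> P n -> is_successor n s -> P s) ->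
  forall n, is_natural n -> P n.
Proof.
  intros HP H0 HS n Hn; destruct (omega_exists M) as [w Hw].
  destruct (comprehension P w HP) as [b Hb]; apply (Hb n), Hn; split.
  - destruct (empty_exists M) as [o Ho]; exists o; split; auto.
    apply Hb; split; auto; now apply Hw, natural_zero.
  - intros m Hm; apply Hb in Hm as [Hm HPm]; apply Hw in Hm.
    destruct (adjoin_exists m m) as [s Hs]; exists s; split; auto.
    apply Hb; split; eauto; eapply Hw, natural_succ; eauto.
Qed.

Lemma natural_cases {M : zf_model} (n : M) :
  is_natural n -> is_empty n \/ exists m, is_natural m /\ is_successor m n.
Proof.
  revert n; refine (natural_ind _ _ _ _).
  - destruct (empty_exists M) as [o _]; definability.
  - auto.
  - intros m s Hm _ Hs; right; now exists m.
Qed.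

(** * Injections and bijections *)

Lemma injection_exists {M : zf_model} (A B : M) (R : M -> M -> Prop) :
  definable (fun p => exists a b, is_pair a b p /\ a ∈ A /\ b ∈ B /\ R a b) ->
  (forall a, a ∈ A -> exists b, b ∈ B /\ R a b) ->
  (forall a b b', a ∈ A -> b ∈ B -> b' ∈ B -> R a b -> R a b' -> b = b') ->
  (forall a a' b, a ∈ A -> a' ∈ A -> b ∈ B -> R a b -> R a' b -> a = a') ->
  exists f, is_injection f A B /\
    (forall a b, maps f a b <-> a ∈ A /\ b ∈ B /\ R a b).
Proof.
  intros HR Htot Huni Hinj.
  destruct (function_exists A B R HR Htot Huni) as (f & Hf & Hm).
  exists f; split; auto; split; auto.
  intros a a' b Ha Ha'; apply Hm in Ha as (Ha & Hb & Hab).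
  apply Hm in Ha' as (Ha' & _ & Hab'); eauto.
Qed.

Lemma injection_empty {M : zf_model} (o B : M) :
  is_empty o -> exists f, is_injection f o B.
Proof.
  intro Ho.
  destruct (injection_exists o B (fun a b => a = b)) as (f & Hf & _).
  - definability.
  - intros a Ha; now apply Ho in Ha.
  - intros a b b' Ha; now apply Ho in Ha.
  - intros a a' b Ha; now apply Ho in Ha.
  - now exists f.
Qed.

Lemma injection_adjoin {M : zf_model} (f A B x y A' B' : M) :
  is_injection f A B -> ~ x ∈ A -> ~ y ∈ B ->
  adjoin A x A' -> adjoin B y B' ->
  exists g, is_injection g A' B' /\
    (forall a b, maps g a b <-> maps f a b \/ a = x /\ b = y).
Proof.
  intros [Hf Hinj] Hx Hy HA HB.
  destruct (injection_exists A' B' (fun a b => maps f a b \/ a = x /\ b = y))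
    as (g & Hg & Hm).
  - definability.
  - intros a Ha; apply HA in Ha as [Ha | ->].
    + destruct (maps_total _ _ _ _ Hf Ha) as [b Hb]; exists b; split; auto.
      apply HB; left; now apply (maps_domain _ _ _ _ _ Hf Hb).
    + exists y; split; auto; apply HB; auto.
  - intros a b b' _ _ _ [H | [Ha Hb]] [H' | [Ha' Hb']]; subst; auto.
    + exact (maps_unique _ _ _ _ _ _ Hf H H').
    + now destruct (maps_domain _ _ _ _ _ Hf H).
    + now destruct (maps_domain _ _ _ _ _ Hf H').
  - intros a a' b _ _ _ [H | [Ha Hb]] [H' | [Ha' Hb']]; subst; auto.
    + exact (Hinj _ _ _ H H').
    + now destruct (maps_domain _ _ _ _ _ Hf H).
    + now destruct (maps_domain _ _ _ _ _ Hf H').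
  - exists g; split; auto; intros a b; rewrite Hm; split; [tauto |].
    intros H; repeat split; auto; destruct H as [H | [-> ->]];
      try (apply HA; auto); try (apply HB; auto);
      left; now apply (maps_domain _ _ _ _ _ Hf H).
Qed.

Lemma bijection_adjoin {M : zf_model} (f A B x y A' B' : M) :
  is_bijection f A B -> ~ x ∈ A -> ~ y ∈ B ->
  adjoin A x A' -> adjoin B y B' -> exists g, is_bijection g A' B'.
Proof.
  intros [Hf Hsur] Hx Hy HA HB.
  destruct (injection_adjoin f A B x y A' B') as (g & Hg & Hm); auto.
  exists g; split; auto; intros b Hb; apply HB in Hb as [Hb | ->].
  - destruct (Hsur b Hb) as (a & Ha & Hab); exists a; rewrite Hm; split; auto; apply HA; auto.
  - exists x; rewrite Hm; split; auto; apply HA; auto.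
Qed.

(** Only the values of [f] have to lie in [C]; the codomain [B] may be larger, as happens when [f]
    maps into [X] and [g] is defined on a finite subset of [X]. *)
Lemma injection_comp {M : zf_model} (f g A B C D : M) :
  is_injection f A B -> is_injection g C D ->
  (forall a b, maps f a b -> b ∈ C) -> exists h, is_injection h A D.
Proof.
  intros [Hf Hfi] [Hg Hgi] HBC.
  destruct (injection_exists A D (fun a c => exists b, maps f a b /\ maps g b c))
    as (h & Hh & _).
  - definability.
  - intros a Ha; destruct (maps_total _ _ _ _ Hf Ha) as [b Hb].
    destruct (maps_total _ _ _ _ Hg (HBC _ _ Hb)) as [c Hc].
    exists c; split; [now apply (maps_domain _ _ _ _ _ Hg Hc) | now exists b].
  - intros a c c' _ _ _ (b & Hb & Hc) (b' & Hb' & Hc').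
    rewrite (maps_unique _ _ _ _ _ _ Hf Hb' Hb) in Hc'.
    exact (maps_unique _ _ _ _ _ _ Hg Hc Hc').
  - intros a a' c _ _ _ (b & Hb & Hc) (b' & Hb' & Hc').
    rewrite (Hgi _ _ _ Hc' Hc) in Hb'; exact (Hfi _ _ _ Hb Hb').
  - now exists h.
Qed.

Lemma bijection_inverse {M : zf_model} (f A B : M) :
  is_bijection f A B -> exists g, is_bijection g B A.
Proof.
  intros [[Hf Hinj] Hsur].
  destruct (injection_exists B A (fun b a => maps f a b)) as (g & Hg & Hm).
  - definability.
  - exact Hsur.
  - intros b a a' _ _ _; apply Hinj.
  - intros b b' a _ _ _; apply (maps_unique _ _ _ _ _ _ Hf).
  - exists g; split; auto; intros a Ha.
    destruct (maps_total _ _ _ _ Hf Ha) as [b Hb]; exists b; rewrite Hm.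
    destruct (maps_domain _ _ _ _ _ Hf Hb); auto.
Qed.

Lemma injection_range {M : zf_model} (f A B Z : M) :
  is_injection f A B -> (forall b, b ∈ Z <-> exists a, maps f a b) ->
  exists g, is_bijection g A Z.
Proof.
  intros [Hf Hinj] HZ.
  destruct (injection_exists A Z (maps f)) as (g & Hg & Hm).
  - definability.
  - intros a Ha; destruct (maps_total _ _ _ _ Hf Ha) as [b Hb].
    exists b; rewrite HZ; eauto.
  - intros a b b' _ _ _; apply (maps_unique _ _ _ _ _ _ Hf).
  - intros a a' b _ _ _; apply Hinj.
  - exists g; split; auto; intros b Hb; pose proof Hb as Hb'.
    apply HZ in Hb' as [a Ha]; exists a; rewrite Hm.
    destruct (maps_domain _ _ _ _ _ Hf Ha); auto.
Qed.

Lemma range_exists {M : zf_model} (f A B : M) :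
  is_function f A B ->
  exists Z, (forall b, b ∈ Z <-> exists a, maps f a b) /\ Z ⊆ B.
Proof.
  intro Hf; destruct (comprehension (fun b => exists a, maps f a b) B) as [Z HZ].
  { definability. }
  exists Z; split; [| intros b Hb; now apply HZ in Hb].
  intro b; rewrite HZ; split; [tauto |]; intros [a Ha]; split; [| now exists a].
  now apply (maps_domain _ _ _ _ _ Hf Ha).
Qed.

(** * The order of the natural numbers and the pigeonhole principle *)

Lemma natural_zero_mem {M : zf_model} (n : M) :
  is_natural n -> forall o, is_empty o -> o ∈ n \/ o = n.
Proof.
  revert n; refine (natural_ind _ _ _ _).
  - destruct (empty_exists M) as [o _]; definability.
  - intros o Ho o' Ho'; right; now apply empty_unique.
  - intros n s _ IH Hs o Ho; left; apply Hs; auto.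
Qed.

Lemma natural_succ_mono {M : zf_model} (m : M) :
  is_natural m -> forall n s t,
  n ∈ m -> is_successor n s -> is_successor m t -> s ∈ t.
Proof.
  revert m; refine (natural_ind _ _ _ _).
  - destruct (empty_exists M) as [o _]; definability.
  - intros o Ho n s t Hn; now apply Ho in Hn.
  - intros m m' Hm IH Hm' n s t Hn Hs Ht; apply Ht.
    apply Hm' in Hn as [Hn | ->].
    + left; exact (IH _ _ _ Hn Hs Hm').
    + right; apply extensionality; intro u.
      specialize (Hs u); specialize (Hm' u); tauto.
Qed.

(* Restricting an injection of [n + 1] into [m + 1] to [n], and moving the
   value [m] to the image of [n], yields an injection of [n] into [m]. *)
Lemma injection_pred {M : zf_model} (f n s m t : M) :
  is_injection f s t -> is_successor n s -> is_successor m t ->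
  exists g, is_injection g n m.
Proof.
  intros [Hf Hinj] Hs Ht.
  assert (Hn : n ∈ s) by (apply Hs; auto).
  destruct (maps_total _ _ _ _ Hf Hn) as [c Hc].
  destruct (maps_domain _ _ _ _ _ Hf Hc) as [_ Hct].
  destruct (injection_exists n m
    (fun a b => maps f a b \/ maps f a m /\ maps f n b)) as (g & Hg & _).
  - definability.
  - intros a Ha; assert (Has : a ∈ s) by (apply Hs; auto).
    destruct (maps_total _ _ _ _ Hf Has) as [b Hb].
    destruct (maps_domain _ _ _ _ _ Hf Hb) as [_ Hbt].
    apply Ht in Hbt as [Hbm | ->]; [now exists b; auto |].
    exists c; split; auto; apply Ht in Hct as [Hcm | ->]; auto.
    rewrite (Hinj _ _ _ Hb Hc) in Ha; now apply mem_irrefl in Ha.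
  - intros a b b' Ha Hb Hb' [H | [H1 H2]] [H' | [H1' H2']].
    + exact (maps_unique _ _ _ _ _ _ Hf H H').
    + rewrite (maps_unique _ _ _ _ _ _ Hf H H1') in Hb.
      now apply mem_irrefl in Hb.
    + rewrite (maps_unique _ _ _ _ _ _ Hf H' H1) in Hb'.
      now apply mem_irrefl in Hb'.
    + exact (maps_unique _ _ _ _ _ _ Hf H2 H2').
  - intros a a' b Ha Ha' Hb [H | [H1 H2]] [H' | [H1' H2']].
    + exact (Hinj _ _ _ H H').
    + rewrite (Hinj _ _ _ H H2') in Ha; now apply mem_irrefl in Ha.
    + rewrite (Hinj _ _ _ H' H2) in Ha'; now apply mem_irrefl in Ha'.
    + exact (Hinj _ _ _ H1 H1').
  - now exists g.
Qed.

(** Induction on [n], for all [m] at once: [injection_pred] strips a successor from both sides, and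
    [natural_succ_mono] puts it back on the resulting membership. *)
Lemma natural_injection_le {M : zf_model} (n : M) :
  is_natural n -> forall m f,
  is_natural m -> is_injection f n m -> n ∈ m \/ n = m.
Proof.
  revert n; refine (natural_ind _ _ _ _).
  - destruct (empty_exists M) as [o _]; definability.
  - intros o Ho m _ Hm _; now apply natural_zero_mem.
  - intros n s Hn IH Hs m f Hm Hf.
    destruct (natural_cases m Hm) as [Hm0 | (m' & Hm' & Hm's)].
    + assert (Hns : n ∈ s) by (apply Hs; auto).
      destruct (maps_total _ _ _ _ (proj1 Hf) Hns) as [b Hb].
      apply (maps_domain _ _ _ _ _ (proj1 Hf)) in Hb as [_ Hb].
      now apply Hm0 in Hb.
    + destruct (injection_pred f n s m' m) as [g Hg]; auto.
      destruct (IH m' g Hm' Hg) as [H | ->].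
      * left; exact (natural_succ_mono m' Hm' _ _ _ H Hs Hm's).
      * right; apply extensionality; intro u.
        specialize (Hs u); specialize (Hm's u); tauto.
Qed.

Lemma natural_injection_antisym {M : zf_model} (n m f g : M) :
  is_natural n -> is_natural m ->
  is_injection f n m -> is_injection g m n -> n = m.
Proof.
  intros Hn Hm Hf Hg.
  destruct (natural_injection_le n Hn m f Hm Hf) as [H | H]; auto.
  destruct (natural_injection_le m Hm n g Hn Hg) as [H' | H']; auto.
  now apply mem_asym in H.
Qed.

Lemma natural_pigeonhole {M : zf_model} (n s f : M) :
  is_natural n -> is_successor n s -> ~ is_injection f s n.
Proof.
  intros Hn Hs Hf.
  assert (Hns : n ∈ s) by (apply Hs; auto).
  destruct (natural_injection_le s (natural_succ n s Hn Hs) n f Hn Hf)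
    as [H | ->].
  - exact (mem_asym _ _ H Hns).
  - exact (mem_irrefl _ Hns).
Qed.

(** * Finite sets *)

Lemma finite_empty {M : zf_model} (o : M) : is_empty o -> finite o.
Proof.
  intro Ho; destruct (injection_empty o o Ho) as [f Hf].
  exists o, f; split; [now apply natural_zero |]; split; auto.
  intros b Hb; now apply Ho in Hb.
Qed.

Lemma finite_adjoin {M : zf_model} (A x B : M) :
  finite A -> adjoin A x B -> finite B.
Proof.
  intros (n & f & Hn & Hf) HB; destruct (classic (x ∈ A)) as [Hx | Hx].
  - replace B with A; [now exists n, f |].
    apply extensionality; intro t; rewrite (HB t); split; [auto |].
    intros [H | ->]; auto.
  - destruct (adjoin_exists n n) as [s Hs].
    destruct (bijection_adjoin f A n x n B s) as [g Hg]; auto.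
    { apply mem_irrefl. }
    exists s, g; split; auto; exact (natural_succ n s Hn Hs).
Qed.

(** Induction on the size [n]. The property to be inherited is given by a set [F] of the model, not
    by a predicate, so that the quantifier over it is first-order and the statement proved by
    induction is definable. *)
Lemma finite_kuratowski {M : zf_model} (n : M) :
  is_natural n -> forall A f, is_bijection f A n -> forall F,
  (forall o, is_empty o -> o ∈ F) ->
  (forall B x B', B ∈ F -> B ⊆ A -> x ∈ A -> adjoin B x B' -> B' ∈ F) -> A ∈ F.
Proof.
  revert n; refine (natural_ind _ _ _ _).
  - destruct (empty_exists M) as [o _]; unfold adjoin; definability.
  - intros o Ho A f [[Hf _] _] F H0 _; apply H0; intros a Ha.
    destruct (maps_total _ _ _ _ Hf Ha) as [b Hb].
    apply (maps_domain _ _ _ _ _ Hf) in Hb as [_ Hb]; now apply Ho in Hb.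
  - intros n s Hn IH Hs A f [[Hf Hinj] Hsur] F H0 HS.
    (* Removing the preimage [x] of the last value [n] leaves a set [A'] that [f] maps bijectively
       onto [n]. *)
    destruct (Hsur n) as (x & Hx & Hxn); [apply Hs; auto |].
    destruct (comprehension (fun a => a <> x) A) as [A' HA'].
    { definability. }
    destruct (injection_exists A' n (maps f)) as (g & Hg & Hm).
    { definability. }
    { intros a Ha; apply HA' in Ha as [Ha Hax].
      destruct (maps_total _ _ _ _ Hf Ha) as [b Hb]; exists b; split; auto.
      destruct (maps_domain _ _ _ _ _ Hf Hb) as [_ Hbs].
      apply Hs in Hbs as [Hbn | ->]; auto; elim Hax; exact (Hinj _ _ _ Hb Hxn). }
    { intros a b b' _ _ _; apply (maps_unique _ _ _ _ _ _ Hf). }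
    { intros a a' b _ _ _; apply Hinj. }
    apply (HS A' x A); auto.
    + apply (IH A' g).
      * split; auto; intros b Hb; destruct (Hsur b) as (a & Ha & Hab).
        { apply Hs; auto. }
        assert (HaA' : a ∈ A').
        { apply HA'; split; auto; intros ->.
          rewrite (maps_unique _ _ _ _ _ _ Hf Hab Hxn) in Hb.
          now apply mem_irrefl in Hb. }
        exists a; rewrite Hm; auto.
      * exact H0.
      * intros B y B' HB HBA' Hy; apply HS; auto.
        -- intros t Ht; now apply HA', HBA'.
        -- now apply HA'.
    + intros t Ht; now apply HA'.
    + intro t; rewrite HA'; split.
      * intro Ht; destruct (classic (t = x)); auto.
      * intros [[Ht _] | ->]; auto.
Qed.

(** [finite_kuratowski] with [F] the set of those subsets of [A] that satisfy [P]. *)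
Lemma finite_ind {M : zf_model} (P : M -> Prop) (A : M) :
  definable P -> finite A ->
  (forall o, is_empty o -> P o) ->
  (forall B x B', P B -> B ⊆ A -> x ∈ A -> adjoin B x B' -> P B') -> P A.
Proof.
  intros HP (n & f & Hn & Hf) H0 HS.
  destruct (power_set M A) as [Q HQ].
  destruct (comprehension P Q HP) as [F HF].
  apply (HF A), (finite_kuratowski n Hn A f Hf).
  - intros o Ho; apply HF; split; auto.
    apply HQ; intros t Ht; now apply Ho in Ht.
  - intros B x B' HB HBA Hx HB'; apply HF in HB as [_ HB]; apply HF; split.
    + apply HQ; intros t Ht; apply HB' in Ht as [Ht | ->]; auto.
    + exact (HS B x B' HB HBA Hx HB').
Qed.

Lemma finite_subset {M : zf_model} (A B : M) : finite A -> B ⊆ A -> finite B.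
Proof.
  intro HA; revert B.
  apply (finite_ind (fun A => forall B, B ⊆ A -> finite B) A); auto.
  - definability.
  - intros o Ho B HB; apply finite_empty; intros t Ht; exact (Ho t (HB t Ht)).
  - intros C x C' IH _ _ HC' B HB.
    (* Without the new element [x], the set [B] becomes a subset [D] of [C], to which the induction
       hypothesis applies. *)
    destruct (comprehension (fun t => t <> x) B) as [D HD].
    { definability. }
    assert (HfD : finite D).
    { apply IH; intros t Ht; apply HD in Ht as [Ht Htx].
      apply HB, HC' in Ht as [Ht | Ht]; tauto. }
    destruct (classic (x ∈ B)) as [Hx | Hx].
    + apply (finite_adjoin D x B HfD); intro t; rewrite HD; split.
      * intro Ht; destruct (classic (t = x)); auto.
      * intros [[Ht _] | ->]; auto.
    + replace B with D; auto; apply extensionality; intro t; rewrite HD.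
      split; [tauto |]; intro Ht; split; auto; now intros ->.
Qed.

Lemma finite_union2 {M : zf_model} (A B C : M) :
  finite A -> finite B -> (forall t, t ∈ C <-> t ∈ A \/ t ∈ B) -> finite C.
Proof.
  intros HA HB; revert C.
  apply (finite_ind
    (fun A => forall C, (forall t, t ∈ C <-> t ∈ A \/ t ∈ B) -> finite C) A);
    auto.
  - definability.
  - intros o Ho C HC; replace C with B; auto.
    apply extensionality; intro t; rewrite HC; specialize (Ho t); tauto.
  - intros D x D' IH _ _ HD' C HC.
    destruct (union2_exists D B) as [E HE].
    apply (finite_adjoin E x C (IH E HE)).
    intro t; rewrite HC, HE, (HD' t); tauto.
Qed.

(** The range of an injection of [n] is finite, so it misses a point of [X], which serves as the
    value at [n]. The induction concerns the mere existence of an injection for each [n], so no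
    sequence of injections is chosen. *)
Lemma natural_injects_infinite {M : zf_model} (X : M) :
  infinite X -> forall n, is_natural n -> exists f, is_injection f n X.
Proof.
  intro HX; refine (natural_ind _ _ _ _).
  - definability.
  - intros o Ho; now apply injection_empty.
  - intros n s Hn [f Hf] Hs.
    destruct (range_exists _ _ _ (proj1 Hf)) as (Z & HZ & HZX).
    destruct (injection_range f n X Z Hf HZ) as [g Hg].
    assert (exists x, x ∈ X /\ ~ x ∈ Z) as (x & Hx & HxZ).
    { apply NNPP; intro H; apply HX.
      destruct (bijection_inverse _ _ _ Hg) as [h Hh].
      replace X with Z; [now exists n, h |].
      apply extensionality; intro t; split; auto; intro Ht.
      apply NNPP; eauto. }
    destruct (adjoin_exists Z x) as [Z' HZ'].
    destruct (injection_adjoin g n Z n x s Z') as (h & Hh & _); auto.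
    { apply Hg. }
    { apply mem_irrefl. }
    (* [h] has codomain [Z']; [k] is the same map with codomain [X]. *)
    destruct (injection_exists s X (maps h)) as (k & Hk & _).
    + definability.
    + intros a Ha; destruct (maps_total _ _ _ _ (proj1 Hh) Ha) as [b Hb].
      exists b; split; auto.
      apply (maps_domain _ _ _ _ _ (proj1 Hh)) in Hb as [_ Hb].
      apply HZ' in Hb as [Hb | ->]; auto.
    + intros a b b' _ _ _; apply (maps_unique _ _ _ _ _ _ (proj1 Hh)).
    + intros a a' b _ _ _; apply (proj2 Hh).
    + now exists k.
Qed.

(** * Spaces whose topology is described by traces on [X] *)

Definition agree_on {M : zf_model} (k z y y' : M) : Prop :=
  forall x, x ∈ z -> (maps k y x <-> maps k y' x).

(* Both spaces are of this form: [k] codes each point [y] by the subset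
   {x : maps k y x} of [X], namely X \ y for S_P(X) and f^-1(1) for the Cantor
   cube, and [R y y'] is y ⊆ y', respectively the trivial relation. *)
Definition trace_open {M : zf_model} (X S k : M) (R : M -> M -> Prop) (V : M)
  : Prop :=
  V ⊆ S /\
  (forall y, y ∈ V -> exists z, finite z /\ z ⊆ X /\
     (forall y', y' ∈ S -> R y y' -> agree_on k z y y' -> y' ∈ V)).

(** The empty set witnesses that [S] is open, and the union of two finite witnesses serves for an
    intersection. *)
Lemma trace_topology {M : zf_model} (X S T k : M) (R : M -> M -> Prop) :
  (forall V, V ∈ T <-> trace_open X S k R V) -> topological_space S T.
Proof.
  intro HT; split; [| split; [| split]].
  - intros V HV; now apply HT in HV as [HV _].
  - apply HT; split; auto; intros y _; destruct (empty_exists M) as [o Ho].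
    exists o; split; [now apply finite_empty |]; split; auto.
    intros t Ht; now apply Ho in Ht.
  - intros V W D HV HW HD; apply HT in HV as [HVS HV]; apply HT in HW as [_ HW].
    apply HT; split.
    + intros t Ht; now apply HVS, HD.
    + intros y Hy; apply HD in Hy as [HyV HyW].
      destruct (HV y HyV) as (z & Hz & HzX & Hz').
      destruct (HW y HyW) as (u & Hu & HuX & Hu').
      destruct (union2_exists z u) as [v Hv]; exists v; split; [| split].
      * exact (finite_union2 z u v Hz Hu Hv).
      * intros t Ht; apply Hv in Ht as [Ht | Ht]; auto.
      * intros y' Hy' HR Ha; apply HD; split.
        -- apply Hz'; auto; intros x Hx; apply Ha, Hv; auto.
        -- apply Hu'; auto; intros x Hx; apply Ha, Hv; auto.
  - intros U V HU HV; apply HT; split.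
    + intros t Ht; apply HV in Ht as (W & HW & Ht).
      apply HU, HT in HW as [HW _]; auto.
    + intros y Hy; apply HV in Hy as (W & HW & Hy).
      destruct (proj2 (proj1 (HT W) (HU W HW)) y Hy) as (z & Hz & HzX & Hz').
      exists z; split; auto; split; auto; intros y' Hy' HR Ha.
      apply HV; exists W; auto.
Qed.

Definition trace_at_least {M : zf_model} (X k n y : M) : Prop :=
  exists g, is_injection g n X /\ (forall a b, maps g a b -> maps k y b).

(** For a natural [n] this says that [V] is the set V_n of the proof idea, in the form common to
    both spaces. *)
Definition is_at_least_set {M : zf_model} (X S k n V : M) : Prop :=
  forall y, y ∈ V <-> y ∈ S /\ trace_at_least X k n y.

Lemma at_least_set_exists {M : zf_model} (X S k n : M) :
  exists V, is_at_least_set X S k n V.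
Proof. apply comprehension; definability. Qed.

Lemma at_least_set_open {M : zf_model} (X S k n : M) (R : M -> M -> Prop) V :
  is_natural n -> is_at_least_set X S k n V -> trace_open X S k R V.
Proof.
  intros Hn HV; split; [intros y Hy; now apply HV |].
  intros y Hy; apply HV in Hy as (_ & g & Hg & Hgk).
  destruct (range_exists _ _ _ (proj1 Hg)) as (z & Hz & HzX).
  destruct (injection_range g n X z Hg Hz) as [h Hh].
  destruct (bijection_inverse _ _ _ Hh) as [h' Hh'].
  exists z; split; [now exists n, h' |]; split; auto.
  intros y' Hy' _ Ha; apply HV; split; auto; exists g; split; auto.
  intros a b Hab; apply Ha; [apply Hz; now exists a | exact (Hgk a b Hab)].
Qed.

(** Supplies the test points: one whose trace has exactly [n] elements, one whose trace is all of
    [X], and one with a given finite trace. *)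
Definition all_traces {M : zf_model} (X S k : M) : Prop :=
  forall z, z ⊆ X -> exists y, y ∈ S /\ (forall x, maps k y x <-> x ∈ z).

(** A point whose trace [z] is the range of an injection of [n] lies in [V], read as V_n. Read as
    V_m, this makes [m] inject into [z], which is in bijection with [n]. *)
Lemma at_least_set_le {M : zf_model} (X S k n m V : M) :
  infinite X -> all_traces X S k -> is_natural n ->
  is_at_least_set X S k n V -> is_at_least_set X S k m V ->
  exists f, is_injection f m n.
Proof.
  intros HX Hk Hn HVn HVm.
  destruct (natural_injects_infinite X HX n Hn) as [g Hg].
  destruct (range_exists _ _ _ (proj1 Hg)) as (z & Hz & HzX).
  destruct (Hk z HzX) as (y & Hy & Hyz).
  assert (HyV : y ∈ V).
  { apply HVn; split; auto; exists g; split; auto.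
    intros a b Hab; apply Hyz, Hz; now exists a. }
  apply HVm in HyV as (_ & g' & Hg' & Hgk).
  destruct (injection_range g n X z Hg Hz) as [h Hh].
  destruct (bijection_inverse _ _ _ Hh) as [h' [Hh' _]].
  apply (injection_comp g' h' m X z n Hg' Hh').
  intros a b Hab; apply Hyz; exact (Hgk a b Hab).
Qed.

(** The index of a member of [U] is unique, by [at_least_set_le] in both directions, so sending each
    V_n to [n] is a definable injection into omega. *)
Lemma at_least_sets_countable {M : zf_model} (X S k U : M) :
  infinite X -> all_traces X S k ->
  (forall V, V ∈ U -> exists n, is_natural n /\ is_at_least_set X S k n V) ->
  countable U.
Proof.
  intros HX Hk HU; destruct (omega_exists M) as [w Hw].
  destruct (injection_exists U w (fun V n => is_at_least_set X S k n V))
    as (f & Hf & _).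
  - definability.
  - intros V HV; destruct (HU V HV) as (n & Hn & HVn); exists n.
    now split; [apply Hw |].
  - intros V n m _ Hn Hm HVn HVm; apply Hw in Hn; apply Hw in Hm.
    destruct (at_least_set_le X S k n m V) as [f Hf]; auto.
    destruct (at_least_set_le X S k m n V) as [g Hg]; auto.
    exact (natural_injection_antisym n m g f Hn Hm Hg Hf).
  - intros V V' n _ _ _ HV HV'; apply extensionality; intro y.
    specialize (HV y); specialize (HV' y); tauto.
  - now exists w, f.
Qed.

(** The last hypothesis puts every point within reach, under [R], of a point of full trace: for
    S_P(X) the latter is the empty set, which is contained in everything, and for the cube [R]
    always holds. *)
Lemma trace_not_P_space {M : zf_model} (X S T k : M) (R : M -> M -> Prop) :
  infinite X ->
  (forall V, V ∈ T <-> trace_open X S k R V) ->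
  all_traces X S k ->
  (forall y y', y ∈ S -> (forall x, x ∈ X -> maps k y x) -> R y y') ->
  ~ P_space S T.
Proof.
  intros HX HT Hk HR [_ HP].
  destruct (comprehension
    (fun V => exists n, is_natural n /\ is_at_least_set X S k n V) T) as [U HU].
  { definability. }
  destruct (comprehension (fun y => forall V, V ∈ U -> y ∈ V) S) as [G HG].
  { definability. }
  assert (HGn : forall y, y ∈ G <->
            y ∈ S /\ forall n, is_natural n -> trace_at_least X k n y).
  { intro y; rewrite HG; split; intros [HyS Hy]; split; auto.
    - intros n Hn; destruct (at_least_set_exists X S k n) as [V HV].
      assert (HVU : V ∈ U).
      { apply HU; split; [| now exists n].
        apply HT; exact (at_least_set_open X S k n R V Hn HV). }
      now apply HV, Hy.
    - intros V HV; apply HU in HV as (_ & n & Hn & HV); apply HV; auto. }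
  assert (HGT : G ∈ T).
  { apply HP; exists U; split; [| split]; auto.
    - apply (at_least_sets_countable X S k); auto.
      intros V HV; now apply HU.
    - intros V HV; now apply HU. }
  (* The point of full trace lies in [G]; if [G] is open, a finite [z] controls a neighbourhood of
     it inside [G]. *)
  destruct (Hk X) as (y & HyS & Hy); auto.
  assert (HyG : y ∈ G).
  { apply HGn; split; auto; intros n Hn.
    destruct (natural_injects_infinite X HX n Hn) as [g Hg].
    exists g; split; auto; intros a b Hab; apply Hy.
    now apply (maps_domain _ _ _ _ _ (proj1 Hg) Hab). }
  destruct (proj2 (proj1 (HT G) HGT) y HyG) as (z & Hz & HzX & HzG).
  (* The point with trace [z] agrees with [y] on [z], hence belongs to that neighbourhood. *)
  destruct (Hk z HzX) as (y' & Hy'S & Hy').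
  assert (Hy'G : y' ∈ G).
  { apply HzG; auto.
    - apply HR; auto; intros x Hx; now apply Hy.
    - intros x Hx; rewrite Hy, Hy'; split; auto. }
  (* With [n] the size of [z], membership of [y'] in [G] makes the successor [s] inject into [z],
     hence into [n]. *)
  destruct Hz as (n & h & Hn & [Hh _]); destruct (adjoin_exists n n) as [s Hs].
  apply HGn in Hy'G as [_ Hy'G].
  destruct (Hy'G s (natural_succ n s Hn Hs)) as (g & Hg & Hgk).
  destruct (injection_comp g h s X z n Hg Hh) as [f Hf].
  - intros a b Hab; apply Hy'; exact (Hgk a b Hab).
  - exact (natural_pigeonhole n s f Hn Hs Hf).
Qed.

(** * The space S_P(X) *)

Lemma SP_space_exists {M : zf_model} (X : M) : exists S T, is_SP_space X S T.
Proof.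
  destruct (power_set M X) as [S HS]; destruct (power_set M S) as [Q HQ].
  destruct (comprehension (fun V => forall x, x ∈ V ->
        exists z d, finite z /\ z ⊆ X /\ disjoint x z /\ is_difference X z d /\
          (forall y, x ⊆ y -> y ⊆ d -> y ∈ V)) Q) as [T HT].
  { definability. }
  exists S, T; split; auto; intro V; rewrite HT, HQ; reflexivity.
Qed.

Lemma SP_space_trace {M : zf_model} (X S T k V : M) :
  is_SP_space X S T ->
  (forall y x, maps k y x <-> y ∈ S /\ x ∈ X /\ ~ x ∈ y) ->
  (V ∈ T <-> trace_open X S k (fun y y' => y ⊆ y') V).
Proof.
  intros [HS HT] Hk; rewrite HT; split; intros [HVS HV]; split; auto;
    intros y Hy; pose proof (HVS y Hy) as HyS.
  - destruct (HV y Hy) as (z & d & Hz & HzX & Hyz & Hd & Hyd).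
    exists z; split; auto; split; auto; intros y' Hy' Hyy' Ha.
    apply Hyd; auto; intros x Hx; apply Hd; split; [now apply (HS y') |].
    (* A point of [z] is outside [y] by disjointness, so it is in the trace of [y] and then, by
       agreement, in that of [y']. *)
    intro Hxz; assert (H : maps k y x).
    { apply Hk; split; auto; split; auto; intro Hxy; now apply (Hyz x). }
    apply Ha in H; auto; now apply Hk in H.
  - destruct (HV y Hy) as (z & Hz & HzX & Hyz).
    (* [z] may meet [y], while the topology of S_P(X) asks for a set disjoint from [y]; so [z] is
       cut down to [u]. On the rest of [z], agreement follows from the inclusion of [y] in [y']. *)
    destruct (comprehension (fun x => ~ x ∈ y) z) as [u Hu].
    { definability. }
    destruct (comprehension (fun x => ~ x ∈ u) X) as [d Hd].
    { definability. }
    exists u, d; split; [| split; [| split; [| split]]]; auto.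
    + apply (finite_subset z); auto; intros x Hx; now apply Hu.
    + intros x Hx; now apply HzX, Hu.
    + intros x [Hx Hxu]; now apply Hu in Hxu.
    + intros y' Hyy' Hy'd.
      assert (Hy' : y' ∈ S) by (apply HS; intros x Hx; now apply Hd, Hy'd).
      apply Hyz; auto; intros x Hx; rewrite !Hk.
      assert (~ x ∈ y -> ~ x ∈ y').
      { intros Hxy Hxy'; apply Hy'd, Hd in Hxy' as [_ H].
        apply H, Hu; auto. }
      specialize (Hyy' x); tauto.
Qed.

Lemma SP_space_not_P_space {M : zf_model} (X S T : M) :
  infinite X -> is_SP_space X S T -> topological_space S T /\ ~ P_space S T.
Proof.
  intros HX HST; pose proof (proj1 HST) as HS.
  destruct (graph_exists S X (fun y x => ~ x ∈ y)) as (k & _ & Hk).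
  { definability. }
  pose proof (fun V => SP_space_trace X S T k V HST Hk) as HT; split.
  - exact (trace_topology _ _ _ _ _ HT).
  - apply (trace_not_P_space _ _ _ _ _ HX HT).
    (* The point with trace [z] is the complement of [z] in [X]. *)
    + intros z Hz; destruct (comprehension (fun x => ~ x ∈ z) X) as [y Hy].
      { definability. }
      exists y; assert (HyS : y ∈ S) by (apply HS; intros x Hx; now apply Hy).
      split; auto; intro x; rewrite Hk, Hy; specialize (Hz x).
      destruct (classic (x ∈ z)); tauto.
    + intros y y' HyS Hy x Hx; pose proof (proj1 (HS y) HyS x Hx) as HxX.
      apply Hy, Hk in HxX; tauto.
Qed.

(** * The Cantor cube *)

Lemma cantor_cube_exists {M : zf_model} (X : M) :
  exists C T, is_cantor_cube X C T.
Proof.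
  destruct (empty_exists M) as [o Ho]; destruct (pairing M o o) as [i Hi].
  destruct (pairing M o i) as [b Hb].
  (* [P] is the product of [X] and [b], so every function from [X] to [b] is a subset of it. *)
  destruct (graph_exists X b (fun _ _ => True)) as (P & _ & HP).
  { definability. }
  destruct (power_set M P) as [Q HQ].
  destruct (comprehension (fun f => is_function f X b) Q) as [C HC].
  { definability. }
  destruct (power_set M C) as [Q' HQ'].
  destruct (comprehension (fun V => forall f, f ∈ V ->
    exists B, is_cantor_basic X C B /\ f ∈ B /\ B ⊆ V) Q') as [T HT].
  { definability. }
  exists C, T; split.
  - exists b; split; [now exists o, i |]; intro f; rewrite HC; split; [tauto |].
    intro Hf; split; auto; apply HQ; intros p Hp.
    destruct (mem_function _ _ _ _ Hf Hp) as (a & c & Hac & Hm).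
    apply (maps_mem P a c p Hac), HP.
    now destruct (maps_domain _ _ _ _ _ Hf Hm).
  - intro V; rewrite HT, HQ'; reflexivity.
Qed.

Lemma two_unique {M : zf_model} (b b' : M) : is_two b -> is_two b' -> b = b'.
Proof.
  intros (o & i & Ho & Hi & Hb) (o' & i' & Ho' & Hi' & Hb').
  rewrite <- (empty_unique o o' Ho Ho') in Hi', Hb'.
  rewrite <- (unordered_pair_unique _ _ _ _ Hi Hi') in Hb'.
  exact (unordered_pair_unique _ _ _ _ Hb Hb').
Qed.

Lemma zero_neq_one {M : zf_model} (o i : M) :
  is_empty o -> is_unordered_pair o o i -> o <> i.
Proof. intros Ho Hi ->; apply (Ho i), Hi; auto. Qed.

(** With only two values available, a function is determined on [z] by the points of [z] where it
    equals [i], so agreement of traces on [z] amounts to extending the same partial function. *)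
Lemma cantor_cube_trace {M : zf_model} (X C T k o i b V : M) :
  ~ is_empty X ->
  is_empty o -> is_unordered_pair o o i -> is_unordered_pair o i b ->
  is_cantor_cube X C T ->
  (forall f x, maps k f x <-> f ∈ C /\ x ∈ X /\ maps f x i) ->
  (V ∈ T <-> trace_open X C k (fun _ _ => True) V).
Proof.
  intros HX Ho Hi Hb [(b' & Hb' & HC) HT] Hk.
  rewrite (two_unique b' b) in HC; [clear b' Hb' | auto | now exists o, i].
  rewrite HT; split; intros [HVC HV]; split; auto;
    intros f Hf; pose proof (HVC f Hf) as HfC; pose proof (proj1 (HC f) HfC) as Hff.
  - destruct (HV f Hf) as (B & (z & b' & p & Hz & _ & HzX & Hb' & Hp & HB) & HfB & HBV).
    rewrite (two_unique b' b) in Hp; [clear b' Hb' | auto | now exists o, i].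
    apply HB in HfB as [_ Hpf].
    exists z; split; auto; split; auto; intros f' Hf' _ Ha.
    pose proof (proj1 (HC f') Hf') as Hff'.
    apply HBV, HB; split; auto; intros q Hq.
    destruct (mem_function _ _ _ _ Hp Hq) as (a & c & Hac & Hm).
    destruct (maps_domain _ _ _ _ _ Hp Hm) as [Haz Hcb].
    assert (Hfac : maps f a c) by (exists q; auto).
    apply (maps_mem f' a c q Hac); apply Hb in Hcb as [-> | ->].
    (* Here [f] takes the value [o] at [a]. If [f'] took the value [i], agreement would force [f] to
       take it as well. *)
    + destruct (maps_total _ _ _ a Hff') as [c Hc]; auto.
      destruct (maps_domain _ _ _ _ _ Hff' Hc) as [_ Hcb].
      apply Hb in Hcb as [-> | ->]; auto.
      assert (H : maps k f' a) by (apply Hk; auto).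
      apply Ha, Hk in H as (_ & _ & H); auto.
      elim (zero_neq_one o i Ho Hi); exact (maps_unique _ _ _ _ _ _ Hff Hfac H).
    + assert (H : maps k f a) by (apply Hk; auto).
      apply Ha, Hk in H; tauto.
  - destruct (HV f Hf) as (z & Hz & HzX & Hfz).
    assert (exists x, x ∈ X) as [x0 Hx0] by (apply NNPP; intro H; apply HX; intros t Ht; eauto).
    (* [z] may be empty, while a basic open set is given by a non-empty domain; hence a point of [X]
       is added. *)
    destruct (adjoin_exists z x0) as [z' Hz'].
    assert (Hz'X : z' ⊆ X) by (intros t Ht; apply Hz' in Ht as [Ht | ->]; auto).
    (* [p] is the restriction of [f] to [z']. *)
    destruct (function_exists z' b (maps f)) as (p & Hp & Hpf).
    { definability. }
    { intros a Ha; destruct (maps_total _ _ _ _ Hff (Hz'X a Ha)) as [c Hc].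
      exists c; split; auto; now apply (maps_domain _ _ _ _ _ Hff Hc). }
    { intros a c c' _ _ _; apply (maps_unique _ _ _ _ _ _ Hff). }
    destruct (comprehension (fun f' => p ⊆ f') C) as [B HB].
    { definability. }
    exists B; split; [| split].
    + exists z', b, p; split; [now apply (finite_adjoin z x0) |].
      split; [intro H; apply (H x0), Hz'; auto |].
      split; auto; split; [now exists o, i | auto].
    + apply HB; split; auto; intros q Hq.
      destruct (mem_function _ _ _ _ Hp Hq) as (a & c & Hac & Hm).
      apply (maps_mem f a c q Hac); now apply Hpf.
    + intros f' Hf'; apply HB in Hf' as [Hf'C Hpf'].
      pose proof (proj1 (HC f') Hf'C) as Hff'.
      apply Hfz; auto; intros x Hx; rewrite !Hk.
      assert (Hxz' : x ∈ z') by (apply Hz'; auto).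
      destruct (maps_total _ _ _ _ Hp Hxz') as [c Hc].
      assert (H1 : maps f x c) by now apply Hpf.
      assert (H2 : maps f' x c) by (destruct Hc as (q & Hq & Hqp); exists q; auto).
      split; intros (_ & HxX & H); split; auto; split; auto.
      * now rewrite (maps_unique _ _ _ _ _ _ Hff H H1).
      * now rewrite (maps_unique _ _ _ _ _ _ Hff' H H2).
Qed.

Lemma cantor_cube_not_P_space {M : zf_model} (X C T : M) :
  infinite X -> is_cantor_cube X C T -> topological_space C T /\ ~ P_space C T.
Proof.
  intros HX HCT; pose proof (proj1 HCT) as (b & (o & i & Ho & Hi & Hb) & HC).
  assert (HX0 : ~ is_empty X) by (intro H; now apply HX, finite_empty).
  destruct (graph_exists C X (fun f x => maps f x i)) as (k & _ & Hk).
  { definability. }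
  pose proof (fun V => cantor_cube_trace X C T k o i b V HX0 Ho Hi Hb HCT Hk)
    as HT; split.
  - exact (trace_topology _ _ _ _ _ HT).
  - apply (trace_not_P_space _ _ _ _ _ HX HT); auto.
    intros z Hz; pose proof (zero_neq_one o i Ho Hi) as Hoi.
    (* The point with trace [z] is the characteristic function of [z]. *)
    destruct (function_exists X b
      (fun x c => x ∈ z /\ c = i \/ ~ x ∈ z /\ c = o)) as (f & Hf & Hm).
    + definability.
    + intros x _; destruct (classic (x ∈ z)); [exists i | exists o];
        (split; [apply Hb |]); auto.
    + intros x c c' _ _ _; intuition congruence.
    + exists f; split; [now apply HC |]; intro x; rewrite Hk, Hm, (HC f).
      assert (i ∈ b) by (apply Hb; auto); specialize (Hz x).
      intuition congruence.
Qed.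

(* The spaces (S, T) and (C, T) are determined by X, by extensionality; they are
   quantified existentially so that the claim includes that they exist. *)
Theorem theorem6p2 (M : zf_model) (X : M) (hX : infinite X) :
  (exists S T, is_SP_space X S T /\ topological_space S T /\ ~ P_space S T) /\
  (exists C T, is_cantor_cube X C T /\ topological_space C T /\ ~ P_space C T).
Proof.
  split.
  - destruct (SP_space_exists X) as (S & T & H); exists S, T; split; auto.
    now apply (SP_space_not_P_space X).
  - destruct (cantor_cube_exists X) as (C & T & H); exists C, T; split; auto.
    now apply (cantor_cube_not_P_space X).
Qed.
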